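(* Let $A=(a_{ij})$ be a real $d\times n$ matrix of rank $d$ with no zero columns, and let $f(\mathbf{z})=\prod_{j=1}^n\bigl(\sum_{i=1}^d a_{ij}z_i\bigr)$. Then the entropic discriminant $V_{\mathbb{C}}(H_A)\subset\mathbb{P}^{d-1}$ equals the image of the Hessian of $f$ under the polar map, in the sense that $$V_{\mathbb{C}}(H_A)\;=\;\text{closure of }\ \nabla_f\bigl(V_{\mathbb{C}}(\mathrm{Hess}(f))\setminus V_{\mathbb{C}}(f)\bigr).$$
   Context: All varieties are in complex projective space. $V_{\mathbb{C}}(g)$ denotes the zero set of a form $g$ in $\mathbb{P}^{d-1}$. The polar map is the rational map $\nabla_f:\mathbb{P}^{d-1}\dashrightarrow\mathbb{P}^{d-1}$, $\mathbf{z}\mapsto(\partial f/\partial z_1(\mathbf{z}):\dots:\partial f/\partial z_d(\mathbf{z}))$, and $\mathrm{Hess}(f)=\det\bigl(\partial^2 f/\partial z_i\partial z_j\bigr)_{1\le i,j\le d}$; its zero set is also called the Hessian of $f$. Let $\mathcal{L}\subset\mathbb{C}^n$ be the row space of $A$ and let the reciprocal plane $\mathcal{L}^{-1}\subset\mathbb{P}^{n-1}$ be the Zariski closure of $\{(1/u_1:\dots:1/u_n): u\in\mathcal{L}\cap(\mathbb{C}^* )^n\}$. The entropic discriminant, as a variety $V_{\mathbb{C}}(H_A)\subset\mathbb{P}^{d-1}$, is the Zariski closure of the set of points $\mathbf{b}\in\mathbb{P}^{d-1}$ such that the intersection $\mathcal{L}^{-1}\cap\{\mathbf{x}\in\mathbb{P}^{n-1}: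 A\mathbf{x}=\mathbf{b}\text{ in }\mathbb{P}^{d-1},\ x_1x_2\cdots x_n\ne 0\}$ has a point of multiplicity $\ge 2$.
   Formalization: The formal theorem assumes n ≥ 2; for n = 1 (hence d = 1) the claim fails: f = az has Hess(f) = 0, so the right-hand side is all of P^0, while the intersection is one reduced point and V(H_A) is empty. *)

(* Defs.v *)
From HB Require Import structures.
From mathcomp Require Import all_boot all_order all_algebra.
From mathcomp Require Import classical_sets reals complex mpoly.

Set Implicit Arguments.
Unset Strict Implicit.
Unset Printing Implicit Defensive.

Import GRing.Theory.
Local Open Scope ring_scope.
Local Open Scope classical_set_scope.

(* A point of the projective space P^(m-1) over K is given
   by its homogeneous coordinates, a nonzero column vector of size m, and a
   subset of P^(m-1) by the (scaling-stable) set of the homogeneous coordinate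
   vectors of its points. *)

Section ProjectiveGeometry.
Variables (K : closedFieldType) (m : nat).
Implicit Types (g h : {mpoly K[m]}) (p x y : 'cV[K]_m) (S : set 'cV[K]_m).

Definition evalv g x : K := g.@[fun i => x i 0].

(* x and y are homogeneous coordinates of the same point. *)
Definition proj_eq x y : Prop := exists2 c : K, c != 0 & x = c *: y.

Definition zero_locus g : set 'cV[K]_m := [set x | x != 0 /\ evalv g x = 0].

Definition vanishes_on S g : Prop := forall x, S x -> evalv g x = 0.

Definition zariski_closure S : set 'cV[K]_m :=
  [set x | x != 0 /\
    forall (e : nat) g, g \is e.-homog -> vanishes_on S g -> evalv g x = 0].

(* For a scaling-stable S this is the homogeneous vanishing ideal of S. *)
Definition vanishing_ideal S : set {mpoly K[m]} := [set g | vanishes_on S g].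

Definition ideal_sum (I J : set {mpoly K[m]}) : set {mpoly K[m]} :=
  [set g | exists g1 g2, [/\ I g1, J g2 & g = g1 + g2]].

(* Let O be the local ring of P^(m-1) at p: the fractions g / s of forms of
   equal degree with s(p) <> 0. For a homogeneous ideal I, the fraction g / s
   lies in the ideal of O defined by I iff some form h with h(p) <> 0
   satisfies h * g \in I; this does not depend on s. *)
Definition local_ideal (I : set {mpoly K[m]}) p : set {mpoly K[m]} :=
  [set g | exists (e : nat) h, [/\ h \is e.-homog, evalv h p != 0 & I (h * g)]].

(* The subscheme of P^(m-1) defined by I has multiplicity at least k at p:
   its local ring O / I_p has dimension at least k over K, that is, contains
   k linearly independent elements. Finitely many elements of O have a common
   denominator, so these can be taken of the form g_0 / s, ..., g_(k-1) / s.
   The multiplicity is 0 off the subscheme, and infinite at the points of its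
   positive-dimensional components. *)
Definition multiplicity_ge (k : nat) (I : set {mpoly K[m]}) p : Prop :=
  exists (e : nat) (s : {mpoly K[m]}) (g : 'I_k -> {mpoly K[m]}),
    [/\ s \is e.-homog, evalv s p != 0, (forall i, g i \is e.-homog) &
        forall c : 'I_k -> K,
          local_ideal I p (\sum_(i < k) c i *: g i) -> forall i, c i = 0].

(* p is a point of multiplicity at least k of the scheme-theoretic
   intersection of the (locally closed, reduced) subvarieties S and S'. *)
Definition intersection_multiplicity_ge (k : nat) S (S' : set 'cV[K]_m) p :=
  (S `&` S') p /\
  multiplicity_ge k (ideal_sum (vanishing_ideal S) (vanishing_ideal S')) p.

Definition gradient g x : 'cV[K]_m := \col_i evalv (g^`M(i)) x.

(* The polar map is only defined where the gradient does not vanish. *)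
Definition polar_image g S : set 'cV[K]_m :=
  [set b | exists z, [/\ S z, gradient g z != 0 & proj_eq b (gradient g z)]].

Definition hessian g : {mpoly K[m]} := \det (\matrix_(i, j) g^`M(j)^`M(i)).

End ProjectiveGeometry.

Section EntropicDiscriminant.
Variables (K : closedFieldType) (d n : nat) (A : 'M[K]_(d, n)).

Definition reciprocal_plane : set 'cV[K]_n :=
  zariski_closure
    [set x | exists u : 'rV[K]_n,
       [/\ (u <= A)%MS, (forall j, u 0 j != 0) &
           proj_eq x (\col_j (u 0 j)^-1)]].

Definition torus_fiber (b : 'cV[K]_d) : set 'cV[K]_n :=
  [set x | [/\ x != 0, proj_eq (A *m x) b & forall j, x j 0 != 0]].

Definition entropic_discriminant : set 'cV[K]_d :=
  zariski_closure
    [set b | b != 0 /\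
       exists x,
         intersection_multiplicity_ge 2 reciprocal_plane (torus_fiber b) x].

Definition product_of_forms : {mpoly K[d]} :=
  \prod_(j < n) \sum_(i < d) A i j *: 'X_i.

End EntropicDiscriminant.

Definition complexify (R : realType) (d n : nat) (A : 'M[R]_(d, n)) :
  'M[R[i]]_(d, n) := map_mx (real_complex R) A.

(* Main.v *)
Require Import Defs.
From HB Require Import structures.
From mathcomp Require Import all_boot all_order all_algebra.
From mathcomp Require Import perm classical_sets reals complex mpoly.
Import GRing.Theory.
Local Open Scope ring_scope.
Local Open Scope classical_set_scope.

Set Implicit Arguments.
Unset Strict Implicit.
Unset Printing Implicit Defensive.

(** The two sets agree before closure. A point x of the reciprocal plane with
    nonzero coordinates is 1/u with u = A^T z, and then grad f (z) = f(z) A x,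
    so that b = A x is the polar image of z. The tangent vectors of the affine
    cone of the reciprocal plane at x are the tangent z y below, and
    Hess(f)(z) y = f(z) A (tangent z y).
    - If Hess(f)(z) y = 0 with y <> 0, then v = tangent z y is tangent to both
      varieties and not proportional to x, since tangent z z = (n - 1) x; the
      1-jet along v shows that the local ring has dimension at least 2.
    - If Hess(f)(z) is invertible, the forms x_1 ... x_n sum_j c_j / x_j
      (A c = 0) and the linear forms defining the fiber have differentials at x
      whose common kernel is the line through x. Expanding them in generators
      of the ideal of the point x and applying Cramer's rule shows that they
      generate this ideal locally, so that the multiplicity is 1. *)

(** * Homogeneity and derivatives of multivariate polynomials *)

Lemma mpoly_ring_ind (R : comRingType) (n : nat) (P : {mpoly R[n]} -> Prop) :
  (forall c, P c%:MP) -> (forall i, P 'X_i) ->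
  (forall g h, P g -> P h -> P (g + h)) ->
  (forall g h, P g -> P h -> P (g * h)) -> forall g, P g.
Proof.
move=> PC PX PD PM g; rewrite (mpolyE g).
apply: (big_ind P) => [||m _]; [by rewrite -mpolyC0 | exact: PD |].
rewrite -mul_mpolyC; apply: (PM) => //; rewrite mpolyXE_id.
apply: (big_ind P) => [||i _]; [by rewrite -mpolyC1 | exact: PM |].
elim: (m i) => [|k IHk]; first by rewrite expr0 -mpolyC1.
by rewrite exprS; apply: PM.
Qed.

Lemma dhomog_prod_card (R : ringType) (n e : nat) (I : finType)
    (F : I -> {mpoly R[n]}) (P : {pred I}) :
  (forall i, P i -> F i \is e.-homog) -> \prod_(i | P i) F i \is (#|P| * e).-homog.
Proof.
move=> homF; rewrite -sum_nat_const.
apply: (big_ind2 (fun p k => p \is k.-homog)) => //; first exact: dhomog1.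
by move=> p1 k1 p2 k2; apply: dhomogM.
Qed.

Lemma dhomogXU (R : ringType) (n : nat) (i : 'I_n) :
  'X_i \is [in R[n], 1.-homog].
Proof. by rewrite dhomogX /= mdeg1. Qed.

Lemma mderivXU (R : ringType) (n : nat) (i j : 'I_n) :
  'X_j^`M(i) = (j == i)%:R :> {mpoly R[n]}.
Proof.
rewrite mderivX mnm1E; have [->|_] := eqVneq j i; last by rewrite scale0r.
have -> : (U_(i) - U_(i) = 0)%MM by apply/mnmP => k; rewrite mnmBE subnn mnm0E.
by rewrite scale1r mpolyX0.
Qed.

(** * Values, directional derivatives and restriction to polynomial curves *)

Section Evaluation.
Variables (K : closedFieldType) (n : nat).
Implicit Types (g h : {mpoly K[n]}) (x v : 'cV[K]_n).

Lemma evalvXU (i : 'I_n) x : evalv 'X_i x = x i 0.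
Proof. exact: mevalXU. Qed.

Lemma evalvC c x : evalv c%:MP x = c.
Proof. exact: mevalC. Qed.

Lemma evalvD g h x : evalv (g + h) x = evalv g x + evalv h x.
Proof. exact: mevalD. Qed.

Lemma evalvB g h x : evalv (g - h) x = evalv g x - evalv h x.
Proof. exact: mevalB. Qed.

Lemma evalvM g h x : evalv (g * h) x = evalv g x * evalv h x.
Proof. exact: mevalM. Qed.

Lemma evalvZ c g x : evalv (c *: g) x = c * evalv g x.
Proof. exact: mevalZ. Qed.

Lemma evalv_sum I (r : seq I) (P : pred I) (F : I -> {mpoly K[n]}) x :
  evalv (\sum_(i <- r | P i) F i) x = \sum_(i <- r | P i) evalv (F i) x.
Proof. exact: raddf_sum. Qed.

Lemma evalv_prod I (r : seq I) (P : pred I) (F : I -> {mpoly K[n]}) x :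
  evalv (\prod_(i <- r | P i) F i) x = \prod_(i <- r | P i) evalv (F i) x.
Proof. exact: rmorph_prod. Qed.

Definition dirderiv g x v : K := \sum_j evalv g^`M(j) x * v j 0.

Lemma dirderivD g h x v :
  dirderiv (g + h) x v = dirderiv g x v + dirderiv h x v.
Proof.
rewrite -big_split; apply: eq_bigr => j _.
by rewrite mderivD evalvD mulrDl.
Qed.

Lemma dirderivM g h x v :
  dirderiv (g * h) x v = evalv g x * dirderiv h x v + dirderiv g x v * evalv h x.
Proof.
rewrite mulr_sumr mulr_suml -big_split; apply: eq_bigr => j _ /=.
by rewrite mderivM evalvD !evalvM mulrDl addrC mulrA mulrAC.
Qed.

Lemma dirderivC c x v : dirderiv c%:MP x v = 0.
Proof. by apply: big1 => j _; rewrite mderivC /evalv meval0 mul0r. Qed.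

Lemma dirderivZ c g x v : dirderiv (c *: g) x v = c * dirderiv g x v.
Proof. by rewrite -mul_mpolyC dirderivM dirderivC evalvC mul0r addr0. Qed.

Lemma dirderivB g h x v :
  dirderiv (g - h) x v = dirderiv g x v - dirderiv h x v.
Proof. by rewrite dirderivD -scaleN1r dirderivZ mulN1r. Qed.

Lemma dirderiv_sum I (r : seq I) (P : pred I) (F : I -> {mpoly K[n]}) x v :
  dirderiv (\sum_(i <- r | P i) F i) x v
  = \sum_(i <- r | P i) dirderiv (F i) x v.
Proof.
apply: (big_morph (fun g => dirderiv g x v)); first by move=> g h; apply: dirderivD.
by rewrite -mpolyC0 dirderivC.
Qed.

Lemma dirderivXU (i : 'I_n) x v : dirderiv 'X_i x v = v i 0.
Proof.
rewrite /dirderiv (bigD1 i) //= big1 => [|j /negPf neji]; rewrite mderivXU.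
  by rewrite eqxx /evalv meval1 mul1r addr0.
by rewrite eq_sym neji /evalv meval0 mul0r.
Qed.

(** The restriction of [g] to the curve t -> X(t). Its coefficients of degree 0 and 1 are the value
    and the derivative of [g] along the curve at t = 0. *)
Definition along (X : 'I_n -> {poly K}) g : {poly K} := mmap (@polyC K) X g.

HB.instance Definition _ X := GRing.RMorphism.copy (along X) (mmap (@polyC K) X).

Lemma alongXU X i : along X 'X_i = X i.
Proof. by rewrite /along mmapX mmap1U. Qed.

Lemma alongC X c : along X c%:MP = c%:P.
Proof. by rewrite /along mmapC. Qed.

Lemma horner_along X g t : (along X g).[t] = evalv g (\col_i (X i).[t]).
Proof.
elim/mpoly_ring_ind: g => [c|i|g h IHg IHh|g h IHg IHh].
- by rewrite alongC hornerC evalvC.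
- by rewrite alongXU evalvXU mxE.
- by rewrite raddfD hornerD IHg IHh evalvD.
- by rewrite rmorphM hornerM IHg IHh evalvM.
Qed.

Lemma coef0_along X g : (along X g)`_0 = evalv g (\col_i (X i)`_0).
Proof.
rewrite -horner_coef0 horner_along; congr evalv.
by apply/colP => i; rewrite !mxE horner_coef0.
Qed.

Lemma coef1M (R : ringType) (p q : {poly R}) :
  (p * q)`_1 = p`_0 * q`_1 + p`_1 * q`_0.
Proof. by rewrite coefM !big_ord_recl big_ord0 addr0. Qed.

Lemma coef1_along X g :
  (along X g)`_1 = dirderiv g (\col_i (X i)`_0) (\col_i (X i)`_1).
Proof.
elim/mpoly_ring_ind: g => [c|i|g h IHg IHh|g h IHg IHh].
- by rewrite alongC coefC dirderivC.
- by rewrite alongXU dirderivXU mxE.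
- by rewrite raddfD coefD IHg IHh dirderivD.
- by rewrite rmorphM coef1M IHg IHh dirderivM !coef0_along.
Qed.

End Evaluation.

(** * Local generators of the ideal of a point *)

Section PointIdeal.
Variables (K : closedFieldType) (n : nat).
Implicit Types (g h l : {mpoly K[n]}) (x v p : 'cV[K]_n) (I : set {mpoly K[n]}).

(** Modulo the differences ['X_j - x j 0 *: l] each variable is a multiple of [l], so a monomial is
    its value at [x] times a power of [l]. Splitting off one variable at a time keeps the quotients
    homogeneous. *)
Lemma monomial_expansion l x e (m : 'X_{1..n}) :
  l \is 1.-homog -> mdeg m = e.+1 ->
  exists q : 'I_n -> {mpoly K[n]}, (forall j, q j \is e.-homog) /\
    'X_[m] = evalv 'X_[m] x *: l ^+ e.+1
             + \sum_j q j * ('X_j - x j 0 *: l).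
Proof.
move=> hom_l; elim: e m => [|e IHe] m degm.
  move/eqP/mdeg1P: degm => [i /eqP->].
  exists (fun j => (j == i)%:R); split=> [j|].
    by case: (j == i); [exact: dhomog1 | exact: dhomog0].
  rewrite (bigD1 i) //= eqxx mul1r big1 => [|j /negPf->]; last by rewrite mul0r.
  by rewrite evalvXU expr1 addr0 addrC subrK.
have [i mi_gt0] : exists i, m i != 0%N.
  case: (pickP (fun i => m i != 0%N)) => [i mi|m0]; first by exists i.
  by move: degm; rewrite mdegE big1 // => i _; apply/eqP/negbFE/m0.
have le_im : (U_(i) <= m)%MM by rewrite lep1mP.
move: degm; rewrite -(submK le_im); set m' := (m - _)%MM.
rewrite mdegD mdeg1 addn1 => -[degm'].
have [q [hom_q Eq]] := IHe _ degm'.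
set c := evalv 'X_[m'] x in Eq.
(* Multiplying the expansion of ['X_[m']] by ['X_i] leaves ['X_i * l ^+ e.+1], which is
   [x i 0 *: l ^+ e.+2] plus [l ^+ e.+1] times the difference of index [i]. *)
exists (fun j => 'X_i * q j + (j == i)%:R * (c *: l ^+ e.+1)); split=> [j|].
  apply: dhomogD; first exact: (dhomogM (dhomogXU _ _)).
  case: (j == i); last by rewrite mul0r dhomog0.
  by rewrite mul1r dhomogZ //; have := dhomogMn e.+1 hom_l; rewrite mul1n.
rewrite mpolyXD evalvM -/c evalvXU.
under eq_bigr do rewrite mulrDl.
rewrite big_split /= [X in _ + (_ + X)](bigD1 i) //= eqxx mul1r.
rewrite [X in _ + (_ + (_ + X))]big1 => [|j /negPf->]; last by rewrite !mul0r.
under eq_bigr do rewrite -mulrA.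
rewrite -mulr_sumr addr0 {1}Eq mulrDl [X in _ + X]mulrC addrC [RHS]addrCA.
congr (_ + _); rewrite mulrBr -!scalerAl -scalerAr -exprSr scalerA.
by rewrite addrC subrK.
Qed.

Lemma form_expansion l x e g :
  l \is 1.-homog -> g \is e.+1.-homog ->
  exists q : 'I_n -> {mpoly K[n]}, (forall j, q j \is e.-homog) /\
    g = evalv g x *: l ^+ e.+1 + \sum_j q j * ('X_j - x j 0 *: l).
Proof.
move=> hom_l /dhomogP hom_g; rewrite (mpolyE g) big_seq.
apply: (big_ind (fun h => exists q : 'I_n -> {mpoly K[n]},
  (forall j, q j \is e.-homog) /\
    h = evalv h x *: l ^+ e.+1 + \sum_j q j * ('X_j - x j 0 *: l))).
- exists (fun=> 0); split=> [j|]; first exact: dhomog0.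
  by rewrite /evalv meval0 scale0r big1 ?addr0 // => j _; rewrite mul0r.
- move=> g1 g2 [q1 [hq1 E1]] [q2 [hq2 E2]].
  exists (fun j => q1 j + q2 j); split=> [j|]; first exact: dhomogD.
  under eq_bigr do rewrite mulrDl.
  by rewrite big_split /= evalvD scalerDl addrACA -E1 -E2.
move=> m m_g; have [q [hq E]] := monomial_expansion x hom_l (hom_g _ m_g).
exists (fun j => g@_m *: q j); split=> [j|]; first exact: dhomogZ.
under eq_bigr do rewrite -scalerAl.
by rewrite -scaler_sumr evalvZ -scalerA -scalerDr -E.
Qed.

Definition is_ideal I : Prop :=
  [/\ I 0, forall g h, I g -> I h -> I (g + h) & forall g h, I h -> I (g * h)].

Lemma ideal_bigsum I (T : Type) (r : seq T) (F : T -> {mpoly K[n]}) :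
  is_ideal I -> (forall i, I (F i)) -> I (\sum_(i <- r) F i).
Proof. by case=> I0 ID _ IF; apply: (big_ind I). Qed.

Lemma vanishing_is_ideal (S : set 'cV[K]_n) : is_ideal (vanishing_ideal S).
Proof.
split=> [x _|g h Ig Ih x Sx|g h Ih x Sx]; first by rewrite /evalv meval0.
  by rewrite evalvD Ig // Ih // addr0.
by rewrite evalvM (Ih x Sx) mulr0.
Qed.

Lemma ideal_sum_is_ideal I J : is_ideal I -> is_ideal J -> is_ideal (ideal_sum I J).
Proof.
move=> [I0 ID IM] [J0 JD JM]; split; first by exists 0, 0; rewrite addr0.
  move=> _ _ [g1 [g2 [Ig1 Jg2 ->]]] [h1 [h2 [Ih1 Jh2 ->]]].
  by exists (g1 + h1), (g2 + h2); rewrite addrACA; split; [apply: ID|apply: JD|].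
move=> g _ [h1 [h2 [Ih1 Jh2 ->]]]; exists (g * h1), (g * h2).
by rewrite mulrDr; split; [apply: IM | apply: JM |].
Qed.

(* Nakayama's lemma made explicit: writing G = H D, where the D j generate the
   ideal of p, some matrix B of scalars inverts H(p) on the left, and the
   adjugate of B H yields det (B H) * D j \in I with det (B H)(p) = 1. The extra
   row of H, which kills D, makes up for the vanishing generator D k. *)
Lemma local_ideal_of_tangent I p (N e : nat) (G : 'I_N -> {mpoly K[n]}) :
  is_ideal I -> p != 0 ->
  (forall i, [/\ I (G i), G i \is e.+1.-homog & evalv (G i) p = 0]) ->
  (forall v, (forall i, dirderiv (G i) p v = 0) -> exists c, v = c *: p) ->
  forall (e' : nat) g, g \is e'.-homog -> evalv g p = 0 -> local_ideal I p g.
Proof.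
move=> idI p_neq0 GP tanG; have [I0 ID IM] := idI.
have [k pk_neq0] : exists k, p k 0 != 0.
  exact/cV0Pn.
(* Normalising the coordinate to the value 1 at [p] makes every [D j] vanish there. *)
pose l : {mpoly K[n]} := (p k 0)^-1 *: 'X_k.
have hom_l : l \is 1.-homog by apply/dhomogZ/dhomogXU.
have lp : evalv l p = 1 by rewrite evalvZ evalvXU mulVf.
pose D j : {mpoly K[n]} := 'X_j - p j 0 *: l.
have Dk : D k = 0 by rewrite /D scalerA divff // scale1r subrr.
have Dp j : evalv (D j) p = 0 by rewrite evalvB evalvXU evalvZ lp mulr1 subrr.
have /(@fin_all_exists _ _ _) [q qP] : forall i, exists qi : 'I_n -> {mpoly K[n]},
    (forall j, qi j \is e.-homog) /\ G i = \sum_j qi j * D j.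
  move=> i; have [_ homG Gp] := GP i.
  have [qi [hqi E]] := form_expansion p hom_l homG.
  by exists qi; split=> //; rewrite [LHS]E Gp scale0r add0r.
(* The extra row carries [l ^+ e] instead of 1: all entries then have degree [e], so the determinant
   below is a form, as [local_ideal] demands. *)
pose H : 'M[{mpoly K[n]}]_(N + 1, n) :=
  col_mx (\matrix_(i, j) q i j) (\matrix_(i, j) ((j == k)%:R * l ^+ e)).
pose Hp : 'M[K]_(N + 1, n) := map_mx (meval (fun i => p i 0)) H.
have homH i j : H i j \is e.-homog.
  rewrite mxE; case: (split i) => i' /=; rewrite mxE; first by have [] := qP i'.
  case: (j == k); last by rewrite mul0r dhomog0.
  by rewrite mul1r; have := dhomogMn e hom_l; rewrite mul1n.
pose Dv : 'cV[{mpoly K[n]}]_n := \col_j D j.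
have IHD i : I ((H *m Dv) i 0).
  rewrite mul_col_mx mxE; case: (split i) => i' /=; rewrite mxE.
    have [IG _ _] := GP i'; have [_ E] := qP i'.
    by under eq_bigr do rewrite !mxE; rewrite -E.
  rewrite big1 // => j _; rewrite !mxE; have [->|_] := eqVneq j k.
    by rewrite Dk mulr0.
  by rewrite !mul0r.
(* The extra row gives [v k 0 = 0]. As the [D j] vanish at [p], the other rows of [Hp] then compute
   the derivatives of the [G i] along [v], so [v] is a multiple of [p], and [p k 0 != 0] makes it
   zero. *)
have Hp_inj v : Hp *m v = 0 -> v = 0.
  rewrite /Hp map_col_mx mul_col_mx => Hv.
  have [H1 H2] :
      (map_mx (meval (fun i => p i 0)) (\matrix_(i < N, j < n) q i j) *m v = 0)
   /\ (map_mx (meval (fun i => p i 0))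
        (\matrix_(i < 1, j < n) ((j == k)%:R * l ^+ e)) *m v = 0).
    by apply: eq_col_mx; rewrite Hv col_mx0.
  have vk : v k 0 = 0.
    move/matrixP/(_ 0 0): H2; rewrite !mxE (bigD1 k) //= big1 ?addr0.
      by rewrite !mxE eqxx mul1r /evalv rmorphXn /= -/(evalv l p) lp expr1n mul1r.
    by move=> j /negPf nejk; rewrite !mxE nejk mul0r /evalv meval0 mul0r.
  have [i|c vE] := tanG v.
    move/matrixP/(_ i 0): H1; rewrite !mxE => H1.
    have [_ ->] := qP i; rewrite dirderiv_sum -[RHS]H1; apply: eq_bigr => j _.
    rewrite !mxE dirderivM Dp mulr0 addr0 dirderivB dirderivXU dirderivZ.
    by rewrite dirderivZ dirderivXU vk !mulr0 subr0.
  move: vk; rewrite vE mxE => /eqP; rewrite mulf_eq0 (negPf pk_neq0) orbF.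
  by move/eqP->; rewrite scale0r.
have [B BHp] : exists B, B *m Hp = 1%:M.
  have : row_full Hp.
    rewrite -cokermx_eq0; apply/eqP/matrixP => i j.
    have /(Hp_inj (col j (cokermx Hp))) : Hp *m col j (cokermx Hp) = 0.
      by rewrite colE mulmxA mulmx_coker mul0mx.
    by move=> /colP/(_ i); rewrite !mxE.
  by case/row_fullP=> B BHp; exists B.
pose BH : 'M[{mpoly K[n]}]_n := map_mx (@mpolyC n K) B *m H.
have homBH i j : BH i j \is e.-homog.
  rewrite mxE; apply: rpred_sum => s _; rewrite mxE mul_mpolyC.
  exact/dhomogZ/homH.
have IBH i : I ((BH *m Dv) i 0).
  rewrite -mulmxA mxE; apply: ideal_bigsum => // j.
  by apply: IM.
have hom_det : \det BH \is (n * e).-homog.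
  apply: rpred_sum => s _; have hom_prod : \prod_i BH i (s i) \is (n * e).-homog.
    by have := @dhomog_prod_card K n e 'I_n _ predT (fun i _ => homBH i (s i));
       rewrite cardT size_enum_ord.
  by case: (odd_perm s); rewrite ?expr0 ?expr1 ?mulN1r ?mul1r ?dhomogN.
have det_p : evalv (\det BH) p = 1.
  rewrite [LHS]/(meval _ _) -det_map_mx map_mxM -map_mx_comp.
  rewrite [X in X *m _](_ : _ = B) ?BHp ?det1 //.
  by apply/matrixP => i j; rewrite mxE; exact: mevalC.
have Idet j : I (\det BH * D j).
  have -> : \det BH * D j = (\adj BH *m (BH *m Dv)) j 0.
    by rewrite mulmxA mul_adj_mx mul_scalar_mx !mxE.
  by rewrite mxE; apply: ideal_bigsum => // i; apply: IM.
(* [form_expansion] needs positive degree; a constant vanishing at [p] is zero. *)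
case=> [|e'] g hom_g gp.
  exists 0%N, 1; split; [exact: dhomog1 | by rewrite /evalv meval1 oner_neq0 |].
  have g_cst : g = (g@_0)%:MP.
    apply/mpolyP => m; rewrite mcoeffC; have [->|m_neq0] := eqVneq m 0%MM.
      by rewrite mulr1.
    by rewrite mulr0 (dhomog_nemf_coeff hom_g) //= mdeg_eq0.
  by rewrite mul1r g_cst -[X in X%:MP](evalvC _ p) -g_cst gp mpolyC0.
exists (n * e)%N, (\det BH); split=> //; first by rewrite det_p oner_neq0.
have [r [_ ->]] := form_expansion p hom_l hom_g.
rewrite gp scale0r add0r mulr_sumr; apply: ideal_bigsum => // j.
by rewrite mulrCA; apply: IM; exact: Idet.
Qed.

End PointIdeal.

(** * Criteria for multiplicity one and multiplicity at least two *)

Section Multiplicity.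
Variables (K : closedFieldType) (n : nat).
Implicit Types (g h : {mpoly K[n]}) (x v p : 'cV[K]_n) (I : set {mpoly K[n]}).

(** Evaluation at [p] has values in the one-dimensional space [K], so two forms of equal degree
    always have a nontrivial combination vanishing at [p]. *)
Lemma multiplicity_lt2 I p :
  (forall e g, g \is e.-homog -> evalv g p = 0 -> local_ideal I p g) ->
  ~ multiplicity_ge 2 I p.
Proof.
move=> Ip [e [s [g [_ _ hom_g free_g]]]].
have Icomb (c : 'I_2 -> K) :
    \sum_i c i * evalv (g i) p = 0 -> forall i, c i = 0.
  move=> cp; apply/free_g/(Ip e); first by apply: rpred_sum => i _; apply: dhomogZ.
  by rewrite evalv_sum -[RHS]cp; apply: eq_bigr => i _; rewrite evalvZ.
have gp (i : 'I_2) : evalv (g i) p = 0.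
  have gp_sub (j : 'I_2) : evalv (g (rev_ord j)) p * (-1) ^+ j = 0.
    (* These coefficients are [g_1(p)] and [- g_0(p)], so the combination cancels at [p]. *)
    apply: (Icomb (fun j => evalv (g (rev_ord j)) p * (-1) ^+ j)).
    rewrite !big_ord_recl big_ord0 /=.
    rewrite [rev_ord ord0](_ : _ = lift ord0 ord0); last exact/val_inj.
    rewrite [rev_ord _](_ : _ = ord0); last exact/val_inj.
    by rewrite expr0 expr1 mulr1 mulrN1 mulNr addr0 mulrC subrr.
  have := gp_sub (rev_ord i); rewrite rev_ordK => /eqP.
  by rewrite mulf_eq0 signr_eq0 orbF => /eqP.
(* Both forms vanish at [p], so their sum does too, although its coefficients are 1. *)
have := Icomb (fun=> 1); rewrite big1 => [/(_ erefl ord0)/eqP|i _].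
  by rewrite oner_eq0.
by rewrite gp mulr0.
Qed.

(** The fractions 1 and [l / 'X_k] are independent, where [l] is a linear form with [l(p) = 0] and
    [l(v) != 0]: evaluation at [p] kills the first coefficient, differentiation along [v] the
    second. *)
Lemma multiplicity_ge2_of_tangent I p v :
  p != 0 -> (forall g, I g -> evalv g p = 0 /\ dirderiv g p v = 0) ->
  (forall c, v <> c *: p) -> multiplicity_ge 2 I p.
Proof.
move=> /cV0Pn[k pk] Ipv v_indep.
have /cV0Pn[j] : v - (v k 0 / p k 0) *: p != 0.
  by rewrite subr_eq0; apply/eqP/v_indep.
rewrite !mxE => vj.
pose l : {mpoly K[n]} := p k 0 *: 'X_j - p j 0 *: 'X_k.
have hom_l : l \is 1.-homog by rewrite rpredB // dhomogZ // dhomogXU.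
have lp : evalv l p = 0 by rewrite evalvB !evalvZ !evalvXU mulrC subrr.
have lv : dirderiv l p v != 0.
  rewrite dirderivB !dirderivZ !dirderivXU.
  apply: contraNneq vj => /eqP; rewrite subr_eq0 => /eqP E.
  by rewrite mulrAC [v k 0 * _]mulrC -E mulrAC divff // mul1r subrr.
exists 1%N, 'X_k, (fun i => if i == ord0 then 'X_k else l); split=> [||i|c].
- exact: dhomogXU.
- by rewrite evalvXU.
- by case: ifP => // _; apply: dhomogXU.
move=> [e [h [_ hp /Ipv[]]]].
rewrite !big_ord_recl big_ord0 addr0 /= evalvM dirderivM !evalvD !dirderivD.
rewrite !evalvZ !dirderivZ evalvXU lp mulr0 addr0 => /eqP.
rewrite !mulf_eq0 (negPf hp) (negPf pk) /= orbF => /eqP c0.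
rewrite c0 !mul0r !add0r mulr0 addr0 => /eqP.
rewrite !mulf_eq0 (negPf hp) (negPf lv) /= orbF => /eqP c1 i.
by case: (unliftP ord0 i) => [i' ->|-> //]; rewrite (ord1 i').
Qed.

End Multiplicity.

(** * Generic vanishing and logarithmic derivatives of products *)

Lemma poly_generic0 (K : closedFieldType) (p q : {poly K}) :
  q != 0 -> (forall t, q.[t] != 0 -> p.[t] = 0) -> p = 0.
Proof.
move=> q_neq0 pq; apply/eqP; apply: contraT => p_neq0.
have /closed_nonrootP[t] : p * q != 0 by rewrite mulf_neq0.
rewrite rootE hornerM mulf_eq0 negb_or => /andP[pt /pq p0].
by rewrite p0 eqxx in pt.
Qed.

(** Logarithmic differentiation at t = 0, legitimate because the constant terms are invertible. *)
Lemma coef_prod_log (K : fieldType) (I : finType) (P : pred I) (F : I -> {poly K}) :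
  (forall i, (F i)`_0 != 0) ->
  (\prod_(i | P i) F i)`_0 = \prod_(i | P i) (F i)`_0 /\
  (\prod_(i | P i) F i)`_1
  = \prod_(i | P i) (F i)`_0 * \sum_(i | P i) (F i)`_1 / (F i)`_0.
Proof.
move=> F0; apply: (big_rec3 (fun s c (p : {poly K}) => p`_0 = c /\ p`_1 = c * s)).
  by rewrite !coefC mulr0.
move=> i s c p _ [p0 p1]; rewrite coef0M coef1M p0 p1; split=> //.
rewrite mulrDr addrC; congr (_ + _); last exact: mulrA.
by rewrite [RHS]mulrCA mulrAC mulfV // mul1r.
Qed.

Lemma dirderiv_prod_log (K : closedFieldType) (n : nat) (x v : 'cV[K]_n)
    (I : finType) (P : pred I) (F : I -> {mpoly K[n]}) :
  (forall i, evalv (F i) x != 0) ->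
  dirderiv (\prod_(i | P i) F i) x v
  = \prod_(i | P i) evalv (F i) x
    * \sum_(i | P i) dirderiv (F i) x v / evalv (F i) x.
Proof.
move=> F0; rewrite -evalv_prod.
apply: (big_rec2 (fun s p => dirderiv p x v = evalv p x * s)).
  by rewrite mulr0 -mpolyC1 dirderivC.
move=> i p s _ IH; rewrite dirderivM evalvM IH.
rewrite mulrDr addrC; congr (_ + _); last exact: mulrA.
by rewrite [RHS]mulrCA mulrAC mulfV // mul1r.
Qed.

Lemma mderiv_prod (R : comRingType) (n : nat) (i : 'I_n) (I : finType)
    (F : I -> {mpoly R[n]}) :
  (\prod_j F j)^`M(i) = \sum_j (F j)^`M(i) * \prod_(k | k != j) F k.
Proof.
elim: (index_enum I) (index_enum_uniq I) => [|a r IHr] /=.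
  by rewrite !big_nil -mpolyC1 mderivC.
case/andP=> a_r /IHr {}IHr; rewrite !big_cons mderivM IHr eqxx; congr (_ * _ + _).
  rewrite [LHS]big_seq [RHS]big_seq_cond; apply: eq_bigl => k.
  by case: eqVneq => [->|]; rewrite ?andbT ?andbF ?(negPf a_r).
rewrite mulr_sumr [LHS]big_seq [RHS]big_seq; apply: eq_bigr => j j_r.
rewrite big_cons; case: eqVneq => [Ea|_]; first by rewrite Ea j_r in a_r.
by rewrite mulrCA.
Qed.

(** * The reciprocal plane, and the gradient and Hessian of a product of linear forms *)

Section EntropicGeometry.
Variables (K : closedFieldType) (d n : nat) (A : 'M[K]_(d, n)).
Implicit Types (z y : 'cV[K]_d) (x u v c : 'cV[K]_n) (b : 'cV[K]_d).

Definition cvinv u : 'cV[K]_n := \col_j (u j 0)^-1.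

Lemma prod_but_one (L : fieldType) (x : 'I_n -> L) j :
  x j != 0 -> \prod_(k | k != j) x k = (\prod_k x k) / x j.
Proof. by move=> xj; rewrite [X in X / _](bigD1 j) //= mulrC mulKf. Qed.

Lemma sum_but_one (L : zmodType) (x : 'I_n -> L) j :
  \sum_(k | k != j) x k = \sum_k x k - x j.
Proof. by rewrite [X in X - _](bigD1 j) //= addrAC subrr add0r. Qed.

(** The columns of [cokermx A] span the kernel of [A], whose annihilator is the row space. *)
Lemma row_space_dual (s : 'cV[K]_n) :
  (forall i, \sum_j cokermx A j i * s j 0 = 0) -> exists y, s = A^T *m y.
Proof.
move=> orth; have /submxP[D sE] : (s^T <= A)%MS.
  rewrite submxE; apply/eqP/rowP => i; rewrite !mxE -[RHS](orth i).
  by apply: eq_bigr => j _; rewrite mxE mulrC.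
by exists D^T; rewrite -trmx_mul -sE trmxK.
Qed.

(** The linear relation [\sum_j c_j / x_j = 0] with its denominators cleared. *)
Definition circuit_form c : {mpoly K[n]} :=
  \sum_j c j 0 *: \prod_(k | k != j) 'X_k.

Lemma circuit_form_homog c : circuit_form c \is n.-1.-homog.
Proof.
apply: rpred_sum => j _; apply: dhomogZ.
have := @dhomog_prod_card K n 1 _ (fun k => 'X_k) [pred k | k != j].
by rewrite muln1 cardC1 card_ord; apply=> k _; apply: dhomogXU.
Qed.

Lemma evalv_circuit_form c x :
  (forall j, x j 0 != 0) ->
  evalv (circuit_form c) x = \prod_k x k 0 * \sum_j c j 0 / x j 0.
Proof.
move=> x_neq0; rewrite evalv_sum mulr_sumr; apply: eq_bigr => j _.
rewrite evalvZ evalv_prod; under eq_bigr do rewrite evalvXU.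
by rewrite (@prod_but_one _ (fun k => x k 0)) // mulrCA.
Qed.

(** Because the sum of the [c j 0 / x j 0] vanishes, differentiating the product of the coordinates
    contributes nothing; only the derivatives of the inverses remain. *)
Lemma dirderiv_circuit_form c x v :
  (forall j, x j 0 != 0) -> \sum_j c j 0 / x j 0 = 0 ->
  dirderiv (circuit_form c) x v
  = - (\prod_k x k 0 * \sum_j c j 0 * (v j 0 / x j 0 ^+ 2)).
Proof.
move=> x_neq0 cx; rewrite dirderiv_sum.
pose t := \sum_k v k 0 / x k 0; pose F := \prod_k x k 0.
transitivity (\sum_j (F * t * (c j 0 / x j 0)
                      - F * (c j 0 * (v j 0 / x j 0 ^+ 2)))).
  apply: eq_bigr => j _; rewrite dirderivZ dirderiv_prod_log => [|k].
    under eq_bigr do rewrite evalvXU.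
    under [X in _ * (_ * X) = _]eq_bigr do rewrite evalvXU dirderivXU.
    rewrite (@prod_but_one _ (fun k => x k 0)) //.
    rewrite (@sum_but_one _ (fun k => v k 0 / x k 0)) -/F -/t.
    rewrite !mulrBr; congr (_ - _).
      by rewrite mulrCA -!mulrA; congr (_ * _); rewrite mulrC -mulrA mulrCA.
    rewrite -!mulrA mulrCA; do 2 congr (_ * _).
    by rewrite mulrCA expr2 invfM.
  by rewrite evalvXU.
by rewrite big_split /= -mulr_sumr cx mulr0 add0r sumrN mulr_sumr.
Qed.

(** At the inverse of [u] in the row space the relation reads [u *m c = 0] up to a scalar.
    Homogeneity carries the vanishing to the closure. *)
Lemma circuit_form_vanishes c :
  A *m c = 0 -> vanishing_ideal (reciprocal_plane A) (circuit_form c).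
Proof.
move=> Ac x [_ /(_ n.-1 _ (circuit_form_homog c))]; apply=> {}x.
case=> u [/submxP[y uE] u_neq0 [k k_neq0 ->]].
rewrite evalv_circuit_form => [|j]; last by rewrite !mxE mulf_neq0 ?invr_eq0.
apply/eqP; rewrite mulf_eq0; apply/orP; right; apply/eqP.
transitivity (k^-1 * (u *m c) 0 0); last by rewrite uE -mulmxA Ac mulmx0 mxE mulr0.
rewrite mxE mulr_sumr; apply: eq_bigr => j _.
by rewrite !mxE invfM invrK mulrC mulrA.
Qed.

(** The closure adds no points in the torus: the circuit forms of the columns of [cokermx A] force
    the coordinatewise inverse of [x] to annihilate the kernel of [A]. *)
Lemma reciprocal_plane_inv x :
  reciprocal_plane A x -> (forall j, x j 0 != 0) ->
  exists z, cvinv x = A^T *m z.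
Proof.
move=> Lx x_neq0; apply: row_space_dual => i.
have : evalv (circuit_form (col i (cokermx A))) x = 0.
  by apply: circuit_form_vanishes Lx; rewrite colE mulmxA mulmx_coker mul0mx.
rewrite evalv_circuit_form // => /eqP; rewrite mulf_eq0.
rewrite (negPf (_ : \prod_k x k 0 != 0)) /=; last by apply/prodf_neq0.
by move/eqP=> E; rewrite -[RHS]E; apply: eq_bigr => j _; rewrite !mxE.
Qed.

Lemma reciprocal_planeI z k :
  (0 < n)%N -> k != 0 -> (forall j, (A^T *m z) j 0 != 0) ->
  reciprocal_plane A (k *: cvinv (A^T *m z)).
Proof.
move=> n_gt0 k_neq0 u_neq0; split.
  apply/cV0Pn; exists (Ordinal n_gt0).
  by rewrite !mxE mulf_neq0 ?invr_eq0 //;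
    have := u_neq0 (Ordinal n_gt0); rewrite mxE.
move=> e g _; apply; exists (A^T *m z)^T; split.
- by rewrite trmx_mul trmxK submxMl.
- by move=> j; rewrite mxE.
by exists k => //; congr (_ *: _); apply/colP => j; rewrite !mxE.
Qed.

Let f := product_of_forms A.

Lemma evalv_form z j :
  evalv (\sum_i A i j *: 'X_i) z = (A^T *m z) j 0.
Proof.
rewrite evalv_sum mxE; apply: eq_bigr => i _.
by rewrite evalvZ evalvXU mxE.
Qed.

Lemma dirderiv_form z y j :
  dirderiv (\sum_i A i j *: 'X_i) z y = (A^T *m y) j 0.
Proof.
rewrite dirderiv_sum mxE; apply: eq_bigr => i _.
by rewrite dirderivZ dirderivXU mxE.
Qed.

Lemma evalv_product z : evalv f z = \prod_j (A^T *m z) j 0.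
Proof. by rewrite evalv_prod; apply: eq_bigr => j _; apply: evalv_form. Qed.

Lemma mderiv_product i :
  f^`M(i) = \sum_j A i j *: \prod_(k | k != j) \sum_l A l k *: 'X_l.
Proof.
rewrite mderiv_prod; apply: eq_bigr => j _.
rewrite -mul_mpolyC; congr (_ * _).
rewrite raddf_sum /= (bigD1 i) //= big1 => [|l neli].
  by rewrite mderivZ mderivXU eqxx addr0 -mul_mpolyC mulr1.
by rewrite mderivZ mderivXU (negPf neli) scaler0.
Qed.

Lemma gradient_product z :
  (forall j, (A^T *m z) j 0 != 0) ->
  gradient f z = evalv f z *: (A *m cvinv (A^T *m z)).
Proof.
move=> u_neq0; apply/colP => i; rewrite !mxE mderiv_product evalv_sum mulr_sumr.
apply: eq_bigr => j _; rewrite evalvZ evalv_prod evalv_product !mxE.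
under eq_bigr do rewrite evalv_form.
rewrite (@prod_but_one _ (fun k => (A^T *m z) k 0)) // !mxE.
by rewrite mulrCA.
Qed.

Definition hessian_at z : 'M[K]_d := \matrix_(i, j) evalv f^`M(j)^`M(i) z.

Lemma evalv_hessian z : evalv (hessian f) z = \det (hessian_at z).
Proof.
rewrite [LHS]/(meval _ _) -det_map_mx; congr (\det _).
by apply/matrixP => i j; rewrite !mxE.
Qed.

(** The derivative along [y] of the map sending [z] to [f(z)] times the inverse of [A^T *m z],
    divided by [f(z)]. *)
Definition tangent z y : 'cV[K]_n :=
  let u := A^T *m z in let w := A^T *m y in
  \col_j ((u j 0)^-1 * (\sum_k w k 0 / u k 0 - w j 0 / u j 0)).

(** The derivative of [gradient_product] along [y]. *)
Lemma hessian_at_mul z y :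
  (forall j, (A^T *m z) j 0 != 0) ->
  hessian_at z *m y = evalv f z *: (A *m tangent z y).
Proof.
move=> u_neq0; apply/colP => i; rewrite mxE.
transitivity (dirderiv f^`M(i) z y).
  by apply: eq_bigr => j _; rewrite mxE mderiv_comm.
rewrite mderiv_product dirderiv_sum [RHS]mxE [X in _ = _ * X]mxE mulr_sumr.
apply: eq_bigr => j _; rewrite dirderivZ dirderiv_prod_log => [|k]; last by rewrite evalv_form.
under eq_bigr do rewrite evalv_form.
under [X in _ * (_ * X) = _]eq_bigr do rewrite evalv_form dirderiv_form.
rewrite (@prod_but_one _ (fun k => (A^T *m z) k 0)) //.
rewrite (@sum_but_one _ (fun k => (A^T *m y) k 0 / (A^T *m z) k 0)).
by rewrite [tangent _ _ _ _]mxE -evalv_product [RHS]mulrCA -!mulrA.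
Qed.

End EntropicGeometry.

(** * Singular Hessians and multiple points of the intersection *)

Section MultiplicityHessian.
Variables (K : closedFieldType) (d n : nat) (A : 'M[K]_(d, n)).
Hypotheses (n_gt1 : (1 < n)%N) (natn1_neq0 : n.-1%:R != 0 :> K).
Hypothesis rankA : row_free A.
Implicit Types (z y : 'cV[K]_d) (x u v c : 'cV[K]_n) (b : 'cV[K]_d).
Let f := product_of_forms A.

Lemma trA_inj y : A^T *m y = 0 -> y = 0.
Proof.
move=> Ay; apply: trmx_inj; rewrite trmx0; apply: (row_free_inj rankA).
by rewrite mul0mx -[LHS]trmxK trmx_mul trmxK Ay trmx0.
Qed.

(** Euler's relation: the map differentiated by [tangent] has coordinates of degree [n.-1]. *)
Lemma tangent_self z :
  (forall j, (A^T *m z) j 0 != 0) ->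
  tangent A z z = n.-1%:R *: cvinv (A^T *m z).
Proof.
move=> u_neq0; apply/colP => j; rewrite mxE [RHS]mxE [X in _ = _ * X]mxE mulrC.
congr (_ * _); rewrite (eq_bigr (fun=> 1)) => [|k _]; last exact: divff.
rewrite sumr_const card_ord divff // -[X in _ *+ X](prednK (ltnW n_gt1)).
by rewrite mulrS addrAC subrr add0r.
Qed.

(** All quotients [w k 0 / u k 0] equal their own sum [s], so [n s = s]; since [n - 1] is
    invertible, [s] and then [w] vanish. *)
Lemma tangent_eq0 z y :
  (forall j, (A^T *m z) j 0 != 0) -> tangent A z y = 0 -> y = 0.
Proof.
set u := A^T *m z; set w := A^T *m y => u_neq0 /colP tan0.
pose s := \sum_k w k 0 / u k 0.
have wE j : w j 0 / u j 0 = s.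
  move: (tan0 j); rewrite mxE [RHS]mxE -/u -/w -/s => /eqP.
  by rewrite mulf_eq0 invr_eq0 (negPf (u_neq0 j)) subr_eq0 eq_sym => /eqP.
have s0 : s = 0.
  have : s *+ n = s by rewrite {2}/s (eq_bigr (fun=> s)) ?sumr_const ?card_ord.
  rewrite -[n in _ *+ n](prednK (ltnW n_gt1)) mulrS -[RHS]addr0 => /addrI/eqP.
  by rewrite -mulr_natr mulf_eq0 (negPf natn1_neq0) orbF => /eqP.
apply: trA_inj; apply/colP => j; rewrite [RHS]mxE -/w.
by apply/eqP; move/eqP: (wE j); rewrite s0 mulf_eq0 invr_eq0 (negPf (u_neq0 j)) orbF.
Qed.

Lemma form_nonzero z : evalv f z != 0 -> forall j, (A^T *m z) j 0 != 0.
Proof. by rewrite evalv_product => /prodf_neq0 H j; apply: H. Qed.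

(** Moving [z] along the line [z + t y] gives the polynomial curve [X], with the stated point and
    velocity at t = 0. Since [g] vanishes on it, so does the linear coefficient. *)
Lemma reciprocal_plane_tangent g z y :
  vanishing_ideal (reciprocal_plane A) g -> evalv f z != 0 ->
  dirderiv g (evalv f z *: cvinv (A^T *m z)) (evalv f z *: tangent A z y) = 0.
Proof.
move=> g0 fz; have u_neq0 := form_nonzero fz.
set u := A^T *m z in u_neq0 *; pose w := A^T *m y.
pose U k : {poly K} := (u k 0)%:P + w k 0 *: 'X.
have U0 k : (U k)`_0 = u k 0 by rewrite coefD coefC coefZ coefX mulr0 addr0.
have U1 k : (U k)`_1 = w k 0 by rewrite coefD coefC coefZ coefX mulr1 add0r.
have U0_neq0 k : (U k)`_0 != 0 by rewrite U0.
pose X j := \prod_(k | k != j) U k.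
pose q := \prod_k U k.
suff along0 : along X g = 0.
  have := coef1_along X g; rewrite along0 coef0 => ->.
  congr dirderiv; apply/colP => j; rewrite mxE [RHS]mxE [X in _ * X = _]mxE /X.
    have [-> _] := coef_prod_log (fun k => k != j) U0_neq0.
    under eq_bigr do rewrite U0.
    by rewrite (@prod_but_one _ _ (fun k => u k 0)) // -evalv_product.
  have [_ ->] := coef_prod_log (fun k => k != j) U0_neq0.
  under eq_bigr do rewrite U0.
  under [X in _ = _ * X]eq_bigr do rewrite U0 U1.
  rewrite (@prod_but_one _ _ (fun k => u k 0)) //.
  rewrite (@sum_but_one _ _ (fun k => w k 0 / u k 0)).
  by rewrite -evalv_product mulrA.
(* The roots of [q] are the parameters at which some coordinate of [A^T *m zt] vanishes; elsewhere
   the curve lies in the reciprocal plane. *)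
apply: (@poly_generic0 _ _ q).
  apply/prodf_neq0 => k _; apply: contraNneq (U0_neq0 k) => ->.
  by rewrite coef0.
move=> t qt; rewrite horner_along; apply: g0.
pose zt := z + t *: y.
have Ut k : (U k).[t] = (A^T *m zt) k 0.
  rewrite mulmxDr -scalemxAr hornerE hornerC hornerZ hornerX [RHS]mxE.
  by rewrite [X in _ = _ + X]mxE mulrC.
have qtE : q.[t] = \prod_k (A^T *m zt) k 0.
  by rewrite horner_prod; apply: eq_bigr => k _; rewrite Ut.
have ut_neq0 j : (A^T *m zt) j 0 != 0.
  by move: qt; rewrite qtE => /prodf_neq0; apply.
rewrite [X in reciprocal_plane A X](_ : _ = q.[t] *: cvinv (A^T *m zt)).
  by apply: reciprocal_planeI => //; apply: ltnW.
apply/colP => j; rewrite mxE [RHS]mxE [X in _ = _ * X]mxE horner_prod.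
under eq_bigr do rewrite Ut.
by rewrite (@prod_but_one _ _ (fun k => (A^T *m zt) k 0)) // -qtE.
Qed.

(** The line [p + t v] has constant image under [A], so it stays in the fiber wherever its
    coordinates are nonzero, that is, for all but finitely many [t]. *)
Lemma torus_fiber_tangent g b p v :
  vanishing_ideal (torus_fiber A b) g -> torus_fiber A b p -> A *m v = 0 ->
  dirderiv g p v = 0.
Proof.
move=> g0 [p_neq0 Ap pj_neq0] Av.
pose X j : {poly K} := (p j 0)%:P + v j 0 *: 'X.
have X0 k : (X k)`_0 = p k 0 by rewrite coefD coefC coefZ coefX mulr0 addr0.
have X1 k : (X k)`_1 = v k 0 by rewrite coefD coefC coefZ coefX mulr1 add0r.
suff along0 : along X g = 0.
  have := coef1_along X g; rewrite along0 coef0 => ->.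
  by congr dirderiv; apply/colP => j; rewrite !mxE.
apply: (@poly_generic0 _ _ (\prod_j X j)).
  apply/prodf_neq0 => k _; apply: contraNneq (pj_neq0 k) => Xk0.
  by rewrite -X0 Xk0 coef0.
move=> t; rewrite horner_prod => /prodf_neq0 Xt; rewrite horner_along; apply: g0.
have E : \col_i (X i).[t] = p + t *: v.
  by apply/colP => j; rewrite !mxE hornerD hornerC hornerZ hornerX mulrC.
split.
- apply/cV0Pn; exists (Ordinal (ltnW n_gt1)); rewrite mxE; exact: Xt.
- by rewrite E mulmxDr -scalemxAr Av scaler0 addr0.
- by move=> j; rewrite mxE; apply: Xt.
Qed.

Lemma hessian_singular z :
  evalv (hessian f) z = 0 -> exists2 y : 'cV[K]_d, y != 0 & hessian_at A z *m y = 0.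
Proof.
rewrite evalv_hessian -det_tr => /eqP/det0P[r r_neq0 Hr].
exists r^T; first by rewrite -trmx0 (inj_eq trmx_inj).
by rewrite -[LHS]trmxK trmx_mul trmxK Hr trmx0.
Qed.

Lemma multiplicity_of_hessian b z :
  evalv (hessian f) z = 0 -> evalv f z != 0 -> gradient f z != 0 ->
  proj_eq b (gradient f z) ->
  exists x, intersection_multiplicity_ge 2 (reciprocal_plane A) (torus_fiber A b) x.
Proof.
move=> Hz fz grad_neq0 [k k_neq0 bE].
have u_neq0 := form_nonzero fz; have gradE := gradient_product u_neq0.
pose p := evalv f z *: cvinv (A^T *m z).
have Ap : A *m p = gradient f z by rewrite gradE scalemxAr.
have [y y_neq0 Hy] := hessian_singular Hz.
pose v := evalv f z *: tangent A z y.
have Av : A *m v = 0 by rewrite -scalemxAr -hessian_at_mul.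
have pj_neq0 j : p j 0 != 0.
  by rewrite mxE [X in _ * X]mxE mulf_neq0 ?invr_eq0.
have p_neq0 : p != 0 by apply/cV0Pn; exists (Ordinal (ltnW n_gt1)).
have Lp : reciprocal_plane A p by apply: reciprocal_planeI => //; apply: ltnW.
have Fp : torus_fiber A b p.
  split=> //; exists k^-1; first by rewrite invr_eq0.
  by rewrite Ap bE scalerA mulVf // scale1r.
exists p; split=> //; apply: (@multiplicity_ge2_of_tangent _ _ _ _ v) => //.
  move=> _ [g1 [g2 [Ig1 Ig2 ->]]]; rewrite evalvD dirderivD (Ig1 p) // (Ig2 p) //.
  rewrite addr0 reciprocal_plane_tangent // (torus_fiber_tangent Ig2) //.
  by rewrite addr0.
(* [A] kills [v] but not [p], so a multiple of [p] equal to [v] must be zero, which would force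
   [y = 0]. *)
move=> c vE; have c0 : c = 0.
  move/eqP: Av; rewrite vE -scalemxAr Ap scaler_eq0 (negPf grad_neq0) orbF.
  by move/eqP.
case/eqP: y_neq0; apply: (tangent_eq0 u_neq0); apply/eqP.
have /eqP := vE; rewrite c0 scale0r scaler_eq0.
by rewrite -/f (negPf fz).
Qed.

Lemma hessian_of_multiplicity b x :
  b != 0 ->
  intersection_multiplicity_ge 2 (reciprocal_plane A) (torus_fiber A b) x ->
  exists z, [/\ evalv (hessian f) z = 0, evalv f z != 0, gradient f z != 0
              & proj_eq b (gradient f z)].
Proof.
move=> b_neq0 [[Lx Fx] mult]; have [x_neq0 [k k_neq0 Ax] xj_neq0] := Fx.
have [z uE] := reciprocal_plane_inv Lx xj_neq0.
have uj j : (A^T *m z) j 0 = (x j 0)^-1 by rewrite -uE mxE.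
have u_neq0 j : (A^T *m z) j 0 != 0 by rewrite uj invr_eq0.
have xE : cvinv (A^T *m z) = x by apply/colP => j; rewrite mxE uj invrK.
have fz : evalv f z != 0 by rewrite evalv_product; apply/prodf_neq0.
have gradE : gradient f z = evalv f z *: (A *m x).
  by rewrite gradient_product // xE.
have Ax_neq0 : A *m x != 0 by rewrite Ax scaler_eq0 negb_or k_neq0.
exists z; split=> //; last first.
- exists (k * evalv f z)^-1; first by rewrite invr_eq0 mulf_neq0.
  by rewrite gradE Ax !scalerA -mulrA [_ * k]mulrC mulVf ?mulf_neq0 // scale1r.
- by rewrite gradE scaler_eq0 negb_or fz.
apply/eqP; apply: contraT; rewrite evalv_hessian => Hz.
have Hinj y : hessian_at A z *m y = 0 -> y = 0.
  move=> Hy; rewrite -[y](mul1mx) -(@mulVmx _ _ (hessian_at A z)).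
    by rewrite -mulmxA Hy mulmx0.
  by rewrite unitmxE unitfE.
case: (@multiplicity_lt2 _ _ _ _ _ mult) => e0 g0.
have /cV0Pn[i0 xi0] := x_neq0.
(* The rows of [W] compose [A] with the linear forms that vanish at [b], so they express that
   [A *m x] is proportional to [b]. *)
pose W := (cokermx b^T)^T *m A.
pose L j : {mpoly K[n]} := \sum_k W j k *: 'X_k.
have L_eval j x' : evalv (L j) x' = (W *m x') j 0.
  by rewrite evalv_sum mxE; apply: eq_bigr => i _; rewrite evalvZ evalvXU.
have L_der j x' v : dirderiv (L j) x' v = (W *m v) j 0.
  by rewrite dirderiv_sum mxE; apply: eq_bigr => i _; rewrite dirderivZ dirderivXU.
have L_fiber j x' : torus_fiber A b x' -> evalv (L j) x' = 0.
  case=> _ [k' _ Ax'] _; rewrite L_eval -mulmxA Ax' -scalemxAr.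
  by rewrite -[b in _ *m b]trmxK -trmx_mul mulmx_coker trmx0 scaler0 mxE.
pose C j := col j (cokermx A).
have AC j : A *m C j = 0 by rewrite /C colE mulmxA mulmx_coker mul0mx.
have C_x j : \sum_i C j i 0 / x i 0 = 0.
  have := circuit_form_vanishes (AC j) Lx.
  rewrite evalv_circuit_form // => /eqP; rewrite mulf_eq0.
  by rewrite (negPf (_ : \prod_k x k 0 != 0)) => [/eqP|]; last exact/prodf_neq0.
(* The power of ['X_i0], nonzero at [x], raises the linear forms to the degree [n.-1] of the circuit
   forms, since all generators must share one degree. *)
pose G (i : 'I_(n + d)) : {mpoly K[n]} :=
  match split i with
  | inl j => circuit_form (C j)
  | inr j => L j * 'X_i0 ^+ n.-2
  end.
have n2E : n.-1 = n.-2.+1 by case: (n) n_gt1 => [|[]].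
apply: (@local_ideal_of_tangent _ _ _ _ _ n.-2 G) => //.
- by apply: ideal_sum_is_ideal; apply: vanishing_is_ideal.
- move=> i; rewrite /G; case: (split i) => j; split.
  + exists (circuit_form (C j)), 0; rewrite addr0; split=> //.
      exact: circuit_form_vanishes.
    by move=> x' _; rewrite /evalv meval0.
  + by rewrite -n2E circuit_form_homog.
  + exact: circuit_form_vanishes Lx.
  + exists 0, (L j * 'X_i0 ^+ n.-2); rewrite add0r; split=> //.
      by move=> x' _; rewrite /evalv meval0.
    by move=> x' Fx'; rewrite evalvM L_fiber // mul0r.
  + rewrite -add1n; apply: dhomogM.
      by apply: rpred_sum => i' _; apply/dhomogZ/dhomogXU.
    by have := dhomogMn n.-2 (dhomogXU K i0); rewrite mul1n.
  + by rewrite evalvM L_fiber // mul0r.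
move=> v tan_v.
(* The differentials of the circuit forms say that [v j 0 / x j 0 ^+ 2] annihilates the kernel of
   [A]. *)
have [y yE] : exists y, (\col_j (v j 0 / x j 0 ^+ 2)) = A^T *m y.
  apply: row_space_dual => j; have := tan_v (lshift d j).
  rewrite /G (unsplitK (inl j)) dirderiv_circuit_form // => /eqP.
  rewrite oppr_eq0 mulf_eq0.
  rewrite (negPf (_ : \prod_k x k 0 != 0)) /=; last exact/prodf_neq0.
  by move/eqP=> E; rewrite -[RHS]E; apply: eq_bigr => i _; rewrite !mxE.
have wE j : (A^T *m y) j 0 = v j 0 / x j 0 ^+ 2 by rewrite -yE mxE.
have [m AvE] : exists m, A *m v = m *: (A *m x).
  have /sub_rVP[a Ea] : ((A *m v)^T <= b^T)%MS.
    rewrite submxE; apply/eqP/trmx_inj; rewrite trmx_mul trmxK trmx0 mulmxA.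
    apply/colP => j; have := tan_v (rshift n j).
    rewrite /G (unsplitK (inr j)) dirderivM L_der L_fiber // mul0r add0r => /eqP.
    rewrite mulf_eq0 orbC /evalv rmorphXn /= mevalXU.
    by rewrite (negPf (expf_neq0 _ xi0)) => /eqP->; rewrite mxE.
  exists (a / k); rewrite Ax scalerA divfK //.
  by rewrite -[LHS]trmxK Ea linearZ /= trmxK.
pose s := \sum_j (A^T *m y) j 0 / (A^T *m z) j 0.
have tanE : tangent A z y = s *: x - v.
  apply/colP => j; rewrite mxE -/s [RHS]mxE [X in _ = X + _]mxE.
  rewrite [X in _ = _ + X]mxE uj invrK.
  rewrite mulrBr wE [s * _]mulrC; congr (_ - _).
  by rewrite mulrCA -[_ * x j 0]/(x j 0 ^+ 2) divfK ?expf_neq0.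
have Hy : hessian_at A z *m y = (evalv f z * (s - m)) *: (A *m x).
  by rewrite hessian_at_mul // tanE mulmxBr AvE -scalemxAr -scalerBl scalerA.
have Hz' : hessian_at A z *m z = (evalv f z * n.-1%:R) *: (A *m x).
  by rewrite hessian_at_mul // tangent_self // xE -scalemxAr scalerA.
(* The Hessian sends both [y] and [z] to multiples of [A *m x]; this ratio makes it kill
   [y - r *: z]. *)
pose r := (s - m) / n.-1%:R.
have yz : y = r *: z.
  apply/eqP; rewrite -subr_eq0; apply/eqP/Hinj.
  by rewrite mulmxBr -scalemxAr Hz' Hy scalerA mulrCA divfK // subrr.
exists r; apply/colP => j; rewrite mxE.
have := wE j; rewrite yz -scalemxAr mxE uj => E.
by rewrite -[LHS](divfK (expf_neq0 2 (xj_neq0 j))) -E expr2 mulrA divfK.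
Qed.

End MultiplicityHessian.

(** * Specialization to the complexification of a real matrix *)

Theorem proposition4 (R : realType) (d n : nat) (A : 'M[R]_(d, n))
    (hn : (1 < n)%N) (hrank : \rank A = d) (hcol : forall j, col j A != 0) :
  let AC := complexify A in
  let f := product_of_forms AC in
  entropic_discriminant AC
  = zariski_closure
      (polar_image f (zero_locus (hessian f) `\` zero_locus f)).
Proof.
move=> AC f.
have rankAC : row_free AC by rewrite /row_free mxrank_map hrank.
have n1 : n.-1%:R != 0 :> R[i].
  by rewrite Num.Theory.pnatr_eq0; case: (n) hn => [|[]].
congr zariski_closure; apply/seteqP; split=> b.
  case=> b_neq0 [x /(hessian_of_multiplicity hn n1 b_neq0)[z]].
  case=> Hz fz grad b_z; exists z; split=> //.
  split; last by case=> _ /eqP; exact/negP.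
  (* Points of [zero_locus] are nonzero; here [z = 0] is excluded because a nonempty product of
     linear forms vanishes at 0. *)
  split=> //; apply: contraNneq fz => z0.
  by rewrite evalv_product z0 mulmx0 (bigD1 (Ordinal hn)) //= mxE mul0r.
case=> z [[[z_neq0 Hz] fz] grad b_z]; split.
  have [k k_neq0 ->] := b_z; by rewrite scaler_eq0 negb_or k_neq0.
apply: multiplicity_of_hessian hn n1 rankAC _ _ Hz _ grad b_z.
by apply/eqP => fz0; apply: fz.
Qed.
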